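(* Let $X,Y$ be positive definite $n\times n$ complex matrices, let $r>0$ and $0<t<1$ be real numbers, and set $m_t=\max\{t,1-t\}$. Then $$\operatorname{Tr}(X:Y)^r+\bigl(m_t^{-1}-m_t^{\,r}\bigr)\,\lVert X^{1-t}Y^t\rVert_r^r\le \operatorname{Tr}X^r+\operatorname{Tr}Y^r .$$
   Context: All matrices are finite-dimensional complex matrices and $\operatorname{Tr}$ is the usual non-normalized trace; $\operatorname{Tr}Z^r$ means $\operatorname{Tr}(Z^r)$. For positive definite $X,Y$ the parallel sum is $X:Y=(X^{-1}+Y^{-1})^{-1}$. For $p>0$ and a matrix $Z$, $\lVert Z\rVert_p=(\operatorname{Tr}|Z|^p)^{1/p}$ with $|Z|=(Z^*Z)^{1/2}$ (a Schatten quasi-norm when $0<p<1$). Real powers of positive definite matrices are defined by functional calculus. *)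

(* Defs.v *)
From mathcomp Require Import all_boot all_order all_algebra.
From mathcomp Require Import complex.
From mathcomp Require Import reals exp.
Set Implicit Arguments.
Unset Strict Implicit.
Unset Printing Implicit Defensive.
Import Order.TTheory GRing.Theory Num.Theory.
Local Open Scope ring_scope.
Local Open Scope complex_scope.
Local Open Scope sesquilinear_scope.

Definition posdefmx (R : realType) (n : nat) (A : 'M[R[i]]_n) : Prop :=
  A \is hermsymmx /\
  forall x : 'cV[R[i]]_n, x != 0 -> 0 < (x ^t* *m A *m x) 0 0.

(* Functional calculus of a Hermitian matrix, from its unitary
   diagonalization A = P^-1 *m diag_mx d *m P with P := spectralmx A.  The
   entries of d are then real, so complex.Re only casts them from R[i] to R. *)
Definition funmx (R : realType) (n : nat) (f : R -> R) (A : 'M[R[i]]_n) :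
    'M[R[i]]_n :=
  invmx (spectralmx A)
  *m diag_mx (map_mx (fun z => (f (complex.Re z))%:C) (spectral_diag A))
  *m spectralmx A.

(* Meaningful on positive semidefinite matrices; as 0 `^ r = 0 for r != 0, it
   is the usual power also on singular ones when 0 < r. *)
Definition powmx (R : realType) (n : nat) (A : 'M[R[i]]_n) (r : R) :
    'M[R[i]]_n :=
  funmx (fun a => a `^ r) A.

Definition absmx (R : realType) (n : nat) (Z : 'M[R[i]]_n) : 'M[R[i]]_n :=
  powmx (Z ^t* *m Z) 2^-1.

(* The trace below is a nonnegative real element of R[i]. *)
Definition schatten (R : realType) (n : nat) (p : R) (Z : 'M[R[i]]_n) : R :=
  (complex.Re (\tr (powmx (absmx Z) p))) `^ p^-1.

Definition parsum (R : realType) (n : nat) (X Y : 'M[R[i]]_n) : 'M[R[i]]_n :=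
  invmx (invmx X + invmx Y).

(* Main.v *)
Require Import Defs.
From mathcomp Require Import all_boot all_order all_algebra.
From mathcomp Require Import complex.
From mathcomp Require Import reals exp.
From mathcomp Require Import ring lra.

(**
Put [S = X^(1-t) Y^t] and [H = S^* S = Y^t X^(2(1-t)) Y^t], so that the Schatten
term is [Tr H^(r/2)].  It suffices to prove the two inequalities

  (1)  Tr (X:Y)^r <= m^r Tr H^(r/2),
  (2)  Tr H^(r/2) <= (1-t) Tr X^r + t Tr Y^r,

since the right-hand side of (2) is at most [m (Tr X^r + Tr Y^r)].

Both rest on one estimate for quadratic forms.  Write [<A>] for the value of the
form of [A] at a unit vector.  Jensen's inequality for the convex functions
[z |-> z^p] with [p >= 1] or [p <= 0] gives [<A^x>^p <= <A^(xp)>], and the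
weighted arithmetic-geometric mean inequality then gives ([qf_young])

  (<A^x> / <B^y>)^(tp) <= t <A^(xp)> + (1-t) <B^(-ys)>

when [tp = (1-t)s], [p >= 1] and [s >= 0].  This is the core of Ando's inequality
comparing the singular values of a product with the eigenvalues of an arithmetic
mean, and it avoids operator monotonicity.  Estimates of forms become estimates
of traces by a dimension count ([spectral_sum_le]): if the eigenvalues of [A]
that are at least [c] were more numerous than those of [B], then some nonzero
vector would lie in the spectral subspace of [A] above [c] and be mapped into
the spectral subspace of [B] below [c].

For (1), with [Z = X:Y], the inverse of [Z] is the sum of the inverses of [X] and
[Y], and the form estimate is applied to negative powers.  The condition
[p >= 1] requires the smaller of [t] and [1-t] to play the role of the weight,
so the cases [t <= 1/2] and [t > 1/2] use different changes of variable
([trace_parsum_le]).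

For (2), the same argument works when [r >= 2(1-t)] ([trace_young_base]).
Smaller exponents are reached by induction ([trace_young]): for [0 < s < 1],

  Tr H^s <= s Tr (H K^-1) + (1-s) Tr K^(s/(1-s)),

and the choice [K = Y^t X^(2(1-t)-r) Y^t], [s = r/2], turns the first trace
into [Tr X^r] and the second into an instance of (2) with a larger exponent.
*)

Set Implicit Arguments.
Unset Strict Implicit.
Unset Printing Implicit Defensive.
Import Order.TTheory GRing.Theory Num.Theory.
Local Open Scope ring_scope.
Local Open Scope complex_scope.
Local Open Scope sesquilinear_scope.

(** * Inequalities for real powers *)

Section Scalar.
Variable R : realType.
Implicit Types c e h k p t x y z : R.

Lemma weighted_amgm t x y : 0 < t -> t < 1 -> 0 < x -> 0 < y ->
  x `^ t * y `^ (1 - t) <= t * x + (1 - t) * y.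
Proof.
move=> t0 t1 x0 y0; have u0 : 0 < 1 - t by rewrite subr_gt0.
have := @conjugate_powR R (x `^ t) (y `^ (1 - t)) t^-1 (1 - t)^-1
  (powR_ge0 _ _) (powR_ge0 _ _).
rewrite !invr_gt0 !invrK -!powRrM.
rewrite !divff ?gt_eqF//.
rewrite (powRr1 (ltW x0)) (powRr1 (ltW y0)).
by rewrite [x * t]mulrC [y * _]mulrC; apply => //; rewrite subrKC.
Qed.

(** Both cases are instances of [weighted_amgm]: for [p > 1] with the numbers
    [z `^ p] and [1], for [p < 0] with [z `^ p] and [z]. *)
Lemma powR_bernoulli z p : 0 < z -> 1 <= p \/ p <= 0 ->
  1 + p * (z - 1) <= z `^ p.
Proof.
move=> z0 [|].
  rewrite le_eqVlt => /predU1P[<-|p1]; first by rewrite powRr1; lra.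
  have p0 : 0 < p by lra.
  have zp0 := powR_gt0 p z0.
  have := @weighted_amgm p^-1 (z `^ p) 1 _ _ zp0 ltr01.
  rewrite invr_gt0 invf_lt1 // powR1 mulr1 -powRrM divff ?gt_eqF// (powRr1 (ltW z0)).
  move=> /(_ p0 p1) H; have {H} : p * z <= p * (p^-1 * z `^ p + (1 - p^-1) * 1).
    by rewrite ler_pM2l.
  by rewrite mulrDr mulrA mulfV ?gt_eqF// mul1r mulr1 mulrBr mulr1 mulfV ?gt_eqF//; lra.
rewrite le_eqVlt => /predU1P[->|p0]; first by rewrite powRr0 mul0r addr0.
have q0 : 0 < 1 - p by lra.
have zp0 := powR_gt0 p z0.
have := @weighted_amgm (1 - p)^-1 (z `^ p) z _ _ zp0 z0.
rewrite invr_gt0 invf_lt1 // -!powRrM -powRD; last by rewrite (gt_eqF z0) implybT.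
have -> : p / (1 - p) + (1 - (1 - p)^-1) = 0 by field; rewrite gt_eqF.
rewrite powRr0 => /(_ q0) H.
have {H} H : 1 <= (1 - p)^-1 * z `^ p + (1 - (1 - p)^-1) * z by apply: H; lra.
have : (1 - p) * 1 <= (1 - p) * ((1 - p)^-1 * z `^ p + (1 - (1 - p)^-1) * z).
  by rewrite ler_pM2l.
rewrite mulrDr !mulrA mulfV ?gt_eqF// mul1r mulr1 mulrBr mulr1 mulfV ?gt_eqF//.
lra.
Qed.

(** Jensen's inequality for power functions, with unnormalized weights. *)
Lemma powR_jensen (I : finType) (w d : I -> R) p :
  (forall i, 0 <= w i) -> 0 < \sum_i w i -> (forall i, 0 < d i) ->
  1 <= p \/ p <= 0 ->
  ((\sum_i w i * d i) / (\sum_i w i)) `^ p * (\sum_i w i)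
    <= \sum_i w i * d i `^ p.
Proof.
move=> w0 W0 d0 hp; set W := \sum_i w i in W0 *; set S := \sum_i w i * d i.
have S0 : 0 < S.
  rewrite lt_neqAle sumr_ge0 ?andbT => [|i _]; last by rewrite mulr_ge0// ltW.
  apply/negP => /eqP/esym/eqP; rewrite psumr_eq0; last first.
    by move=> i _; rewrite mulr_ge0// ltW.
  move=> /allP H; move: W0; rewrite /W big1 ?ltxx// => i _.
  have := H i; rewrite mem_index_enum => /(_ isT) /=.
  by rewrite mulf_eq0 (gt_eqF (d0 i)) orbF => /eqP.
(* Each [d i] is compared with the weighted mean [c] by Bernoulli's inequality;
   the first-order terms cancel in the sum. *)
set c := S / W; have c0 : 0 < c by rewrite divr_gt0.
have -> : c `^ p * W = \sum_i w i * (c `^ p * (1 + p * (d i / c - 1))).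
  have E : W * c = S by rewrite /c mulrC divfK ?gt_eqF.
  transitivity (c `^ p * (W + p * (S / c - W))).
    by rewrite -E mulfK ?gt_eqF// subrr mulr0 addr0.
  rewrite /S /W !mulr_suml -sumrB mulr_sumr -big_split mulr_sumr /=.
  by apply: eq_bigr => i _; ring.
apply: ler_sum => i _; apply: ler_wpM2l => //.
have -> : d i `^ p = c `^ p * (d i / c) `^ p.
  by rewrite -powRM ?ltW ?divr_gt0// mulrC divfK ?gt_eqF.
by apply: ler_wpM2l; rewrite ?powR_ge0//; apply: powR_bernoulli; rewrite ?divr_gt0.
Qed.

(** In the application [a / N] and [b / N] are normalized forms [<A^x>] and
    [<B^y>], and the hypotheses on [A] and [B] come from Jensen's inequality. *)
Lemma young_ratio (a b N A B t p s : R) :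
  0 < a -> 0 < b -> 0 < N -> 0 < t -> t < 1 ->
  (a / N) `^ p * N <= A -> (b / N) `^ (- s) * N <= B -> t * p = (1 - t) * s ->
  (a / b) `^ (t * p) * N <= t * A + (1 - t) * B.
Proof.
move=> a0 b0 N0 t0 t1 hA hB e.
have aN : 0 < a / N by rewrite divr_gt0.
have bN : 0 < b / N by rewrite divr_gt0.
have -> : (a / b) `^ (t * p) = ((a / N) `^ p) `^ t * ((b / N) `^ (- s)) `^ (1 - t).
  have -> : a / b = (a / N) * (b / N) `^ (-1).
    by rewrite powR_inv1 ?ltW//; field; rewrite !gt_eqF.
  rewrite (powRM _ (ltW aN) (powR_ge0 _ _)) -!powRrM.
  congr (_ `^ _ * _ `^ _); first by ring.
  by rewrite e; ring.
apply: le_trans (_ : (t * (a / N) `^ p + (1 - t) * (b / N) `^ (- s)) * N <= _).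
  by rewrite ler_pM2r// weighted_amgm// powR_gt0.
by rewrite mulrDl -!mulrA lerD// ler_pM2l// subr_gt0.
Qed.

Lemma powR_le_root c x e : 0 < c -> 0 < x -> 0 < e ->
  (c <= x `^ e) = (c `^ e^-1 <= x).
Proof.
move=> c0 x0 e0; apply/idP/idP => h.
  have := ge0_ler_powR (ltW (_ : 0 < e^-1)) _ _ h; rewrite invr_gt0 !nnegrE.
  rewrite -powRrM mulfV ?gt_eqF// (powRr1 (ltW x0)); apply => //; first exact: ltW.
  exact: powR_ge0.
have := ge0_ler_powR (ltW e0) _ _ h; rewrite !nnegrE -powRrM mulVf ?gt_eqF//.
by rewrite (powRr1 (ltW c0)); apply; rewrite ?powR_ge0 ?ltW.
Qed.

Lemma lt_powR2 h k : 0 < h -> h `^ 2^-1 < k -> h < k `^ 2.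
Proof.
move=> h0 hk; have k0 : 0 < k := le_lt_trans (powR_ge0 _ _) hk.
have := gt0_ltr_powR (ltr0n R 2) _ _ hk; rewrite !nnegrE powR_ge0 (ltW k0).
by rewrite -powRrM mulVf ?pnatr_eq0// (powRr1 (ltW h0)); apply.
Qed.

End Scalar.

(** * Quadratic forms and functional calculus *)

Section Forms.
Variable R : realType.
Notation C := R[i].

(** The squared modulus of a complex number, as a real number. *)
Definition nsq (z : C) : R := complex.Re z ^+ 2 + complex.Im z ^+ 2.

Lemma nsqE z : z * Num.conj z = (nsq z)%:C.
Proof. by rewrite -normCK -add_Re2_Im2. Qed.

Lemma nsq_ge0 z : 0 <= nsq z.
Proof. by rewrite addr_ge0// sqr_ge0. Qed.

Lemma nsq_eq0 z : (nsq z == 0) = (z == 0).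
Proof. by rewrite paddr_eq0 ?sqr_ge0// !sqrf_eq0 eq_complex. Qed.

Lemma ReZ (a : R) (z : C) : complex.Re (a%:C * z) = a * complex.Re z.
Proof. by case: z => u w /=; rewrite mul0r subr0. Qed.

Lemma ReD (z w : C) : complex.Re (z + w) = complex.Re z + complex.Re w.
Proof. by case: z => ? ?; case: w. Qed.

Lemma Re_sum (I : Type) (s : seq I) (F : I -> C) :
  complex.Re (\sum_(i <- s) F i) = \sum_(i <- s) complex.Re (F i).
Proof. by elim/big_rec2: _ => // i y z _ <-; rewrite ReD. Qed.

Lemma conj_real (a : R) : Num.conj (a%:C : C) = a%:C.
Proof. by apply/CrealP; rewrite complex_real. Qed.

Lemma adjmxM m n p (A : 'M[C]_(m, n)) (B : 'M[C]_(n, p)) :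
  (A *m B)^t* = B^t* *m A^t*.
Proof. by rewrite trmx_mul map_mxM. Qed.

Lemma hermsymmxP n (A : 'M[C]_n) : reflect (A^t* = A) (A \is hermsymmx).
Proof.
apply: (iffP (is_hermitianmxP _ _ _)); rewrite expr0 scale1r; first by move<-.
by [].
Qed.

(** The value at a row vector [v] of the quadratic form of [A].  When [A]
    is Hermitian this value is real, and the real part only casts it to [R]. *)
Definition qf n (A : 'M[C]_n) (v : 'rV[C]_n) : R :=
  complex.Re ((v *m A *m v^t*) 0 0).

Lemma qfD n (A B : 'M[C]_n) v : qf (A + B) v = qf A v + qf B v.
Proof. by rewrite /qf mulmxDr mulmxDl mxE ReD. Qed.

Lemma qfZ n (a : R) (A : 'M[C]_n) v : qf (a%:C *: A) v = a * qf A v.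
Proof. by rewrite /qf -scalemxAr -scalemxAl mxE ReZ. Qed.

Lemma qf_conj n (T A : 'M[C]_n) v : qf (T *m A *m T^t*) v = qf A (v *m T).
Proof. by rewrite /qf adjmxM !mulmxA. Qed.

(** The Hermitian matrix with eigenvalues [d]; when [P] is unitary, the rows of
    [P] form an orthonormal basis of eigenvectors. *)
Definition recmx n (P : 'M[C]_n) (d : 'I_n -> R) : 'M[C]_n :=
  P^t* *m diag_mx (\row_i (d i)%:C) *m P.

Lemma adj_unitaryK n (P : 'M[C]_n) : P \is unitarymx -> P^t* *m P = 1%:M.
Proof. by move=> uP; rewrite -(invmx_unitary uP) mulVmx ?unitarymx_unit. Qed.

Lemma recmx1 n (P : 'M[C]_n) : P \is unitarymx -> recmx P (fun=> 1) = 1%:M.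
Proof.
move=> uP; rewrite /recmx (_ : \row_i _ = const_mx 1); last first.
  by apply/rowP => i; rewrite !mxE.
by rewrite diag_const_mx mulmx1 adj_unitaryK.
Qed.

Lemma eq_recmx n (P : 'M[C]_n) d e : d =1 e -> recmx P d = recmx P e.
Proof.
move=> de; rewrite /recmx (_ : \row_i (d i)%:C = \row_i (e i)%:C) //.
by apply/rowP => i; rewrite !mxE de.
Qed.

Lemma recmxM n (P : 'M[C]_n) d e : P \is unitarymx ->
  recmx P d *m recmx P e = recmx P (fun i => d i * e i).
Proof.
move=> uP; rewrite /recmx.
pose rv (g : 'I_n -> R) : 'rV[C]_n := \row_i (g i)%:C.
have -> : \row_i (d i * e i)%:C = \row_i (rv d 0 i * rv e 0 i).
  by apply/rowP => i; rewrite !mxE rmorphM.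
by rewrite -mulmx_diag !mulmxA mulmxtVK.
Qed.

Lemma recmx_adj n (P : 'M[C]_n) d : (recmx P d)^t* = recmx P d.
Proof.
rewrite /recmx !adjmxM trmxCK mulmxA.
rewrite (_ : (diag_mx _)^t* = diag_mx (\row_i (d i)%:C)) //.
apply/matrixP => i j; rewrite !mxE eq_sym.
by case: eqP => [->|_]; rewrite ?mulr1n ?mulr0n ?conj_real ?conjC0.
Qed.

Lemma qf_recmx n (P : 'M[C]_n) d v :
  qf (recmx P d) v = \sum_i nsq ((v *m P^t*) 0 i) * d i.
Proof.
have -> : qf (recmx P d) v = qf (diag_mx (\row_i (d i)%:C)) (v *m P^t*).
  by rewrite -qf_conj trmxCK.
rewrite /qf mul_mx_diag !mxE Re_sum; apply: eq_bigr => i _.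
by rewrite !mxE mulrAC nsqE -rmorphM.
Qed.

Lemma tr_recmx n (P : 'M[C]_n) d : P \is unitarymx ->
  \tr (recmx P d) = (\sum_i d i)%:C.
Proof.
move=> uP; rewrite /recmx mxtrace_mulC mulmxA (unitarymxP uP) mul1mx mxtrace_diag.
by rewrite rmorph_sum; apply: eq_bigr => i _; rewrite mxE.
Qed.

(** The eigenvalues of a Hermitian matrix, with multiplicity, in the order of its
    spectral decomposition. *)
Definition evals n (A : 'M[C]_n) (i : 'I_n) : R :=
  complex.Re (spectral_diag A 0 i).

Lemma funmxE n (f : R -> R) (A : 'M[C]_n) :
  funmx f A = recmx (spectralmx A) (f \o evals A).
Proof.
rewrite /funmx /recmx (invmx_unitary (spectral_unitarymx A)).
rewrite (_ : map_mx _ _ = \row_i (f (evals A i))%:C) //.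
by apply/rowP => i; rewrite [LHS]mxE [RHS]mxE.
Qed.

Lemma hermitian_recmx n (A : 'M[C]_n) : A \is hermsymmx ->
  recmx (spectralmx A) (evals A) = A.
Proof.
move=> hA; have E := orthomx_spectralP (hermitian_normalmx hA).
rewrite (invmx_unitary (spectral_unitarymx A)) in E.
apply: etrans (esym E); rewrite /recmx.
rewrite (_ : \row_i _ = spectral_diag A) //.
apply/rowP => i; rewrite [LHS]mxE /evals RRe_real//.
have /mxOverP := hermitian_spectral_diag_real hA; exact.
Qed.

Lemma similar_intertwine n (P P' Q Q' D E : 'M[C]_n) :
  P *m P' = 1%:M -> P' *m P = 1%:M -> Q *m Q' = 1%:M -> Q' *m Q = 1%:M ->
  P' *m D *m P = Q' *m E *m Q <-> Q *m P' *m D = E *m (Q *m P').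
Proof.
move=> PP' P'P QQ' Q'Q; split=> [H|H].
  have := congr1 (fun M => Q *m M *m P') H.
  by rewrite -!mulmxA PP' mulmx1 !mulmxA QQ' mul1mx.
have := congr1 (fun M => Q' *m M *m P) H.
by rewrite !mulmxA Q'Q mul1mx -!mulmxA P'P mulmx1.
Qed.

(** Functional calculus does not depend on the chosen diagonalization: the change
    of basis [W] between two of them satisfies [W i j * d j = e i * W i j], so
    that [d j = e i], hence [f (d j) = f (e i)], wherever [W i j != 0]. *)
Lemma recmx_uniq n (P Q : 'M[C]_n) d e (f : R -> R) :
  P \is unitarymx -> Q \is unitarymx -> recmx P d = recmx Q e ->
  recmx P (f \o d) = recmx Q (f \o e).
Proof.
move=> uP uQ dec.
have key D E := similar_intertwine D E (unitarymxP uP) (adj_unitaryK uP)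
  (unitarymxP uQ) (adj_unitaryK uQ).
have /matrixP H := (key _ _).1 dec; apply/key/matrixP => i j.
have := H i j; move: (Q *m P^t*) => W.
rewrite !mul_mx_diag !mul_diag_mx ![matrix_of_fun _ _ i j]mxE !mxE.
have [->|w0] := eqVneq (W i j) 0; first by rewrite !mulr0 !mul0r.
by rewrite mulrC => /(mulIf w0) [/= ->]; rewrite mulrC.
Qed.

Lemma funmx_recmx n (P : 'M[C]_n) d f : P \is unitarymx ->
  funmx f (recmx P d) = recmx P (f \o d).
Proof.
move=> uP; rewrite funmxE; apply: recmx_uniq; rewrite ?spectral_unitarymx//.
by apply: hermitian_recmx; apply/hermsymmxP; exact: recmx_adj.
Qed.

End Forms.

(** * Powers of positive definite matrices *)

Section PosDef.
Variable R : realType.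
Notation C := R[i].

Lemma sum_nsq_gt0 n (v : 'rV[C]_n) : v != 0 -> 0 < \sum_i nsq (v 0 i).
Proof.
move=> v0; rewrite lt_neqAle sumr_ge0 ?andbT => [|i _]; last exact: nsq_ge0.
apply: contra v0 => /eqP/esym/eqP; rewrite psumr_eq0 => [/allP H|i _]; last first.
  exact: nsq_ge0.
apply/eqP/rowP => i; rewrite mxE; apply/eqP; rewrite -nsq_eq0.
by apply: H; rewrite mem_index_enum.
Qed.

Lemma mul_unitary_neq0 n (P : 'M[C]_n) (v : 'rV[C]_n) : P \is unitarymx ->
  v != 0 -> v *m P^t* != 0.
Proof.
move=> uP; apply: contra => /eqP H.
by rewrite -[v]mulmx1 -(adj_unitaryK uP) mulmxA H mul0mx.
Qed.

Lemma qf1 n (P : 'M[C]_n) v : P \is unitarymx ->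
  qf 1%:M v = \sum_i nsq ((v *m P^t*) 0 i).
Proof.
by move=> uP; rewrite -(recmx1 uP) qf_recmx; apply: eq_bigr => i _; rewrite mulr1.
Qed.

Lemma qf1_gt0 n (v : 'rV[C]_n) : v != 0 -> 0 < qf 1%:M v.
Proof.
move=> v0; have u1 : (1%:M : 'M[C]_n) \is unitarymx.
  by apply/unitarymxP; rewrite mul1mx trmx1 map_mx1.
by rewrite (qf1 v u1) sum_nsq_gt0// mul_unitary_neq0.
Qed.

(** [posdefmx] in terms of row vectors. *)
Lemma posdefmxP n (A : 'M[C]_n) :
  posdefmx A <-> A^t* = A /\ forall v : 'rV[C]_n, v != 0 -> 0 < qf A v.
Proof.
split=> [[/hermsymmxP hA pA]|[hA pA]]; split=> //.
- move=> v v0; have := pA (v^t*); rewrite trmxCK ltcE => /(_ _)/andP[]//.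
  by apply: contra v0 => /eqP H; rewrite -[v]trmxCK H trmx0 map_mx0.
- exact/hermsymmxP.
- move=> x x0; have := pA (x^t*); rewrite /qf trmxCK.
  have y0 : x^t* != 0.
    by apply: contra x0 => /eqP H; rewrite -[x]trmxCK H trmx0 map_mx0.
  move=> /(_ y0); set z := (_ *m _ *m _) 0 0 => z0.
  have zr : z \is Num.real.
    have hM : (x^t* *m A *m x)^t* = x^t* *m A *m x.
      by rewrite !adjmxM trmxCK hA mulmxA.
    by apply/CrealP; rewrite /z -[in RHS]hM [RHS]mxE [in RHS]mxE.
  by rewrite -(RRe_real zr) ltcR.
Qed.

Lemma posdef_qf_gt0 n (A : 'M[C]_n) v : posdefmx A -> v != 0 -> 0 < qf A v.
Proof. by move=> /posdefmxP[_]; apply. Qed.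

Lemma posdef_recmx n (P : 'M[C]_n) d : P \is unitarymx -> (forall i, 0 < d i) ->
  posdefmx (recmx P d).
Proof.
move=> uP d0; apply/posdefmxP; split=> [|v v0]; first exact: recmx_adj.
have /sum_nsq_gt0 := mul_unitary_neq0 uP v0.
rewrite qf_recmx !lt_neqAle eq_sym psumr_eq0 => [|i _]; last exact: nsq_ge0.
move=> /andP[H _]; rewrite sumr_ge0 ?andbT => [|i _]; last first.
  by rewrite mulr_ge0 ?nsq_ge0 ?ltW.
rewrite eq_sym psumr_eq0 => [|i _]; last by rewrite mulr_ge0 ?nsq_ge0 ?ltW.
apply: contra H => /allP H; apply/allP => i /H /=.
by rewrite mulf_eq0 (gt_eqF (d0 i)) orbF.
Qed.

Lemma posdefD n (A B : 'M[C]_n) : posdefmx A -> posdefmx B -> posdefmx (A + B).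
Proof.
move=> /posdefmxP[hA pA] /posdefmxP[hB pB]; apply/posdefmxP; split=> [|v v0].
  by rewrite linearD /= map_mxD hA hB.
by rewrite qfD addr_gt0 ?pA ?pB.
Qed.

Lemma posdefZ n (a : R) (A : 'M[C]_n) : 0 < a -> posdefmx A ->
  posdefmx (a%:C *: A).
Proof.
move=> a0 /posdefmxP[hA pA]; apply/posdefmxP; split=> [|v v0].
  by rewrite linearZ /= map_mxZ hA; congr (_ *: _); exact: conj_real.
by rewrite qfZ mulr_gt0// pA.
Qed.

Lemma posdef_conj n (T A : 'M[C]_n) : T \in unitmx -> posdefmx A ->
  posdefmx (T *m A *m T^t*).
Proof.
move=> uT /posdefmxP[hA pA]; apply/posdefmxP; split=> [|v v0].
  by rewrite !adjmxM trmxCK hA mulmxA.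
rewrite qf_conj pA//; apply: contra v0 => /eqP H.
by rewrite -[v](mulmxK uT) H mul0mx.
Qed.

Lemma evals_gt0 n (A : 'M[C]_n) i : posdefmx A -> 0 < evals A i.
Proof.
move=> pA; have [hA _] := pA; have uP := spectral_unitarymx A.
have E : row i (spectralmx A) *m (spectralmx A)^t* = delta_mx 0 i.
  by rewrite -row_mul (unitarymxP uP) row1.
have -> : evals A i = qf A (row i (spectralmx A)).
  rewrite -{2}(hermitian_recmx hA) qf_recmx E (bigD1 i)//= big1 ?addr0.
    by rewrite mxE !eqxx /nsq /= expr1n expr0n addr0 mul1r.
  move=> j /negPf ji; rewrite mxE ji andbF /nsq /=.
  by rewrite expr0n addr0 mul0r.
apply: posdef_qf_gt0 => //; apply/eqP => H; move: E; rewrite H mul0mx.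
move=> /rowP/(_ i); rewrite !mxE !eqxx => /eqP.
by rewrite eq_sym oner_eq0.
Qed.

Section Powers.
Variables (n : nat) (A : 'M[C]_n).
Hypothesis pA : posdefmx A.
Let P := spectralmx A.
Let uP : P \is unitarymx. Proof. exact: spectral_unitarymx. Qed.

Lemma powmxE r : powmx A r = recmx P (fun i => evals A i `^ r).
Proof. by rewrite /powmx funmxE; apply: eq_recmx. Qed.

Lemma adj_powmx r : (powmx A r)^t* = powmx A r.
Proof. by rewrite powmxE recmx_adj. Qed.

Lemma posdef_powmx r : posdefmx (powmx A r).
Proof.
by rewrite powmxE; apply: posdef_recmx => // i; rewrite powR_gt0// evals_gt0.
Qed.

Lemma powmxD x y : powmx A x *m powmx A y = powmx A (x + y).
Proof.
rewrite !powmxE (recmxM _ _ uP); apply: eq_recmx => i; rewrite powRD //.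
by rewrite (gt_eqF (evals_gt0 i pA)) implybT.
Qed.

Lemma powmx0 : powmx A 0 = 1%:M.
Proof. by rewrite powmxE -(recmx1 uP); apply: eq_recmx => i; rewrite powRr0. Qed.

Lemma powmx1 : powmx A 1 = A.
Proof.
have [hA _] := pA; rewrite powmxE -[RHS](hermitian_recmx hA).
by apply: eq_recmx => i; rewrite powRr1 ?ltW ?evals_gt0.
Qed.

Lemma powmx_powmx x y : powmx (powmx A x) y = powmx A (x * y).
Proof.
rewrite powmxE [LHS](funmx_recmx _ _ uP) powmxE.
by apply: eq_recmx => i /=; rewrite powRrM.
Qed.

Lemma powmx_unit r : powmx A r \in unitmx.
Proof.
have := powmxD r (- r); rewrite subrr powmx0 => H.
exact: (mulmx1_unit H).1.
Qed.

Lemma powmxN1 : powmx A (- 1) = invmx A.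
Proof.
have E : powmx A (-1) *m A = 1%:M by rewrite -{2}powmx1 powmxD addrC subrr powmx0.
have uA : A \in unitmx by rewrite -powmx1 powmx_unit.
by rewrite -[LHS](mulmxK uA) E mul1mx.
Qed.

Lemma tr_powmx r : \tr (powmx A r) = (\sum_i evals A i `^ r)%:C.
Proof. by rewrite powmxE tr_recmx. Qed.

Lemma qf_powmx r v :
  qf (powmx A r) v = \sum_i nsq ((v *m P^t*) 0 i) * evals A i `^ r.
Proof. by rewrite powmxE qf_recmx. Qed.

(** The weights in Jensen's inequality are the squared moduli of the coordinates
    of [v] in an eigenbasis of [A]. *)
Lemma qf_jensen x p v : v != 0 -> 1 <= p \/ p <= 0 ->
  (qf (powmx A x) v / qf 1%:M v) `^ p * qf 1%:M v <= qf (powmx A (x * p)) v.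
Proof.
move=> v0 hp; rewrite [X in (X / _) `^ _ * _ <= _]qf_powmx.
rewrite [X in _ <= X]qf_powmx (qf1 v uP).
rewrite (eq_bigr _ (fun i _ => congr1 _ (powRrM (evals A i) x p))).
apply: powR_jensen => // [i||i]; first exact: nsq_ge0.
  exact/sum_nsq_gt0/mul_unitary_neq0.
by rewrite powR_gt0// evals_gt0.
Qed.

End Powers.

Lemma posdef_inv n (A : 'M[C]_n) : posdefmx A -> posdefmx (invmx A).
Proof. by move=> pA; rewrite -(powmxN1 pA); exact: posdef_powmx. Qed.

(** The Young inequality for quadratic forms on which both trace inequalities
    rest. *)
Lemma qf_young n (A B : 'M[C]_n) v x y t p s :
  posdefmx A -> posdefmx B -> v != 0 -> 0 < t -> t < 1 -> 1 <= p -> 0 <= s ->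
  t * p = (1 - t) * s ->
  (qf (powmx A x) v / qf (powmx B y) v) `^ (t * p) * qf 1%:M v
    <= t * qf (powmx A (x * p)) v + (1 - t) * qf (powmx B (y * - s)) v.
Proof.
move=> pA pB v0 t0 t1 p1 s0 e.
apply: (young_ratio (N := qf 1%:M v) _ _ _ t0 t1 _ _ e).
- exact: (posdef_qf_gt0 (posdef_powmx pA x) v0).
- exact: (posdef_qf_gt0 (posdef_powmx pB y) v0).
- exact: qf1_gt0.
- exact: (qf_jensen pA x v0 (or_introl p1)).
- by apply: (qf_jensen pB y v0); right; rewrite oppr_le0.
Qed.

End PosDef.

(** * Comparison of spectra *)

(** Removing the largest entry of [s1] and a larger entry of [s2] preserves the
    hypothesis on counts. *)
Lemma sum_le_of_count (R : realDomainType) (s1 s2 : seq R) :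
  all (>= 0) s2 ->
  (forall c, 0 < c -> (count (>= c) s1 <= count (>= c) s2)%N) ->
  \sum_(x <- s1) x <= \sum_(x <- s2) x.
Proof.
wlog s1s : s1 / sorted >=%R s1.
  move=> H h2 h; rewrite -(perm_big _ (permEl (perm_sort >=%R s1))) /=.
  apply: H => //; first by apply: sort_sorted => x y; exact: le_total.
  by move=> c /h; rewrite count_sort.
elim: s1 s2 s1s => [|m s1 IH] s2 /= s1s h2 h.
  by rewrite big_nil big_seq sumr_ge0// => x /(allP h2).
have mmax : all (<= m) s1.
  by apply: order_path_min s1s => x y z /= yx zy; exact: le_trans zy yx.
have [m0|m0] := leP m 0.
  apply: (@le_trans _ _ 0); last first.
    by rewrite big_seq sumr_ge0// => x /(allP h2).
  rewrite big_cons -[leRHS]addr0 lerD// big_seq sumr_le0// => x /(allP mmax) xm.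
  exact: le_trans xm m0.
have /hasP[m' m's2 mm'] : has (>= m) s2.
  by rewrite has_count (leq_trans _ (h m m0))//= lexx.
have pm' := perm_to_rem m's2.
rewrite (perm_big _ pm') !big_cons lerD// IH//.
- exact: path_sorted s1s.
- by apply/allP => x /mem_rem /(allP h2).
move=> c c0; have := h c c0; rewrite (permP pm') /=.
have [cm|cm] := leP c m; first by rewrite (le_trans cm mm') !add1n ltnS.
move=> _; rewrite (_ : count _ s1 = 0%N)//; apply/eqP.
rewrite -leqn0 leqNgt -has_count -all_predC.
by apply: sub_all mmax => x /= xm; rewrite -ltNge (le_lt_trans xm).
Qed.

(** A homogeneous linear system with more unknowns than equations, the unknowns
    being the entries indexed by [I] of a row vector. *)
Lemma supported_solution (F : fieldType) n (M : 'M[F]_n) (I J : {set 'I_n}) :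
  (#|J| < #|I|)%N -> exists2 x : 'rV[F]_n, x != 0 &
    (forall i, x 0 i != 0 -> i \in I)
    /\ (forall j, (x *m M) 0 j != 0 -> j \notin J).
Proof.
move=> JI; pose f (k : 'I_#|I|) : 'I_n := enum_val k.
pose A : 'M[F]_(#|I|, #|J|) := \matrix_(i, j) M (f i) (enum_val j).
have : kermx A != 0.
  by rewrite -mxrank_eq0 mxrank_ker -lt0n subn_gt0 (leq_ltn_trans (rank_leq_col A)).
rewrite -nz_row_eq0; have := nz_row_sub (kermx A).
set u := nz_row _ => /sub_kermxP uA u0.
pose E : 'M[F]_(#|I|, n) := \matrix_(k, i) (f k == i)%:R.
have uE k : (u *m E) 0 (f k) = u 0 k.
  rewrite mxE (bigD1 k)//= big1 ?addr0 ?mxE ?eqxx ?mulr1// => l lk.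
  by rewrite mxE (inj_eq enum_val_inj) (negPf lk) mulr0.
exists (u *m E); last split.
- apply: contra u0 => /eqP H; apply/eqP/rowP => k.
  by rewrite -uE H !mxE.
- move=> i; apply: contraR => iI; apply/eqP; rewrite mxE big1// => k _.
  rewrite mxE; case: eqP => [fk|_]; last by rewrite mulr0.
  by move: iI; rewrite -fk /f enum_valP.
- move=> j; apply: contra => jJ.
  have EM k : (E *m M) k j = A k (enum_rank_in jJ j).
    rewrite !mxE enum_rankK_in// (bigD1 (f k))//= big1 ?addr0.
      by rewrite mxE eqxx mul1r.
    by move=> i ik; rewrite mxE eq_sym (negPf ik) mul0r.
  rewrite -mulmxA mxE (eq_bigr (fun k => u 0 k * A k (enum_rank_in jJ j))).
    by have /rowP/(_ (enum_rank_in jJ j)) := uA; rewrite !mxE => ->.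
  by move=> k _; rewrite EM.
Qed.

Section Trace.
Variable R : realType.
Notation C := R[i].

(** A comparison of spectra in the style of Courant and Fischer.  The hypothesis
    says that no nonzero [v] is spanned by eigenvectors of [A] on which [f] is at
    least [c] while [v *m T] is spanned by eigenvectors of [B] on which [g] is less
    than [c].  By a dimension count, at least as many values [g (evals B j)] as
    values [f (evals A i)] are then at least [c]. *)
Lemma spectral_sum_le n (A B T : 'M[C]_n) (f g : R -> R) :
  (forall j, 0 <= g (evals B j)) ->
  (forall c (v : 'rV[C]_n), 0 < c -> v != 0 ->
     (forall i, (v *m (spectralmx A)^t*) 0 i != 0 -> c <= f (evals A i)) ->
     (forall j, (v *m T *m (spectralmx B)^t*) 0 j != 0 -> g (evals B j) < c) ->
     False) ->
  \sum_i f (evals A i) <= \sum_i g (evals B i).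
Proof.
move=> g0 H.
pose S (h : 'I_n -> R) := [seq h i | i <- enum 'I_n].
have SE h : \sum_i h i = \sum_(x <- S h) x by rewrite big_map big_enum.
rewrite !SE; apply: sum_le_of_count => [|c c0].
  by apply/allP => _ /mapP[j _ ->] /=.
have cS h : count (>= c) (S h) = #|[set i | c <= h i]|.
  rewrite cardE size_filter count_map enumT.
  by apply: eq_count => i /=; rewrite inE.
rewrite !cS leqNgt; apply/negP => lt.
have uP := spectral_unitarymx A.
have [x x0 [xI xJ]] :=
  supported_solution (spectralmx A *m T *m (spectralmx B)^t*) lt.
have vP := mulmxtVK x uP.
apply: (H c (x *m spectralmx A) c0).
- by apply: contra x0 => /eqP v0; rewrite -vP v0 mul0mx.
- by move=> i; rewrite vP => /xI; rewrite inE.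
- by move=> j; have := xJ j; rewrite !mulmxA => h /h; rewrite inE -ltNge.
Qed.
End Trace.

(** * A variational bound for traces of powers *)

Section Variational.
Variable R : realType.
Notation C := R[i].

Lemma sum_row_nsq n (W : 'M[C]_n) i : W \is unitarymx ->
  \sum_j nsq (W i j) = 1.
Proof.
move=> uW; apply: complexI; rewrite rmorph_sum rmorph1 /=.
have /matrixP/(_ i i) := unitarymxP uW; rewrite mxE [RHS]mxE eqxx; apply: etrans.
by apply: eq_bigr => j _; rewrite -nsqE !mxE.
Qed.

Lemma sum_col_nsq n (W : 'M[C]_n) j : W \is unitarymx ->
  \sum_i nsq (W i j) = 1.
Proof.
move=> uW; apply: complexI; rewrite rmorph_sum rmorph1 /=.
have /matrixP/(_ j j) := adj_unitaryK uW; rewrite mxE [RHS]mxE eqxx; apply: etrans.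
by apply: eq_bigr => i _; rewrite -nsqE !mxE mulrC.
Qed.

(** The trace of a product, computed in an eigenbasis of the first factor. *)
Lemma Re_tr_recmxM n (P G : 'M[C]_n) h :
  complex.Re (\tr (recmx P h *m G)) = \sum_i h i * qf G (row i P).
Proof.
rewrite /recmx -!mulmxA mxtrace_mulC -!mulmxA /mxtrace Re_sum.
apply: eq_bigr => i _; rewrite mul_diag_mx mxE mxE ReZ; congr (_ * complex.Re _).
by rewrite mulmxA -!row_mul mxE; rewrite !mxE; apply: eq_bigr => j _; rewrite !mxE.
Qed.

(** A variational bound for the trace of a power; equality holds for
    [K = H ^ (1 - s)].  The squared moduli of the entries of the unitary change of
    basis between eigenbases of [H] and [K] form a doubly stochastic matrix, which
    reduces the bound to the weighted arithmetic-geometric mean inequality. *)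
Lemma trace_powmx_variational n (H K : 'M[C]_n) s : posdefmx H -> posdefmx K ->
  0 < s -> s < 1 ->
  \sum_i evals H i `^ s <=
    s * complex.Re (\tr (H *m powmx K (- 1)))
    + (1 - s) * \sum_j evals K j `^ (s / (1 - s)).
Proof.
move=> pH pK s0 s1; have uP := spectral_unitarymx H; have uQ := spectral_unitarymx K.
pose W := spectralmx H *m (spectralmx K)^t*.
have uW : W \is unitarymx by apply: mul_unitarymx; rewrite ?trmxC_unitary.
have -> : complex.Re (\tr (H *m powmx K (- 1)))
    = \sum_i \sum_j nsq (W i j) * (evals H i * evals K j `^ (- 1)).
  rewrite -{1}(hermitian_recmx pH.1) Re_tr_recmxM; apply: eq_bigr => i _.
  rewrite qf_powmx mulr_sumr; apply: eq_bigr => j _.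
  by rewrite -row_mul [row _ _ _ _]mxE; ring.
have -> : \sum_i evals H i `^ s = \sum_i \sum_j nsq (W i j) * evals H i `^ s.
  by apply: eq_bigr => i _; rewrite -mulr_suml (sum_row_nsq i uW) mul1r.
have -> : \sum_j evals K j `^ (s / (1 - s))
    = \sum_i \sum_j nsq (W i j) * evals K j `^ (s / (1 - s)).
  rewrite exchange_big; apply: eq_bigr => j _ /=.
  by rewrite -mulr_suml (sum_col_nsq j uW) mul1r.
rewrite !mulr_sumr -big_split; apply: ler_sum => i _ /=.
rewrite !mulr_sumr -big_split; apply: ler_sum => j _ /=.
set h := evals H i; set k := evals K j.
have h0 : 0 < h := evals_gt0 i pH; have k0 : 0 < k := evals_gt0 j pK.
rewrite [s * _]mulrCA [(1 - s) * _]mulrCA -mulrDr ler_wpM2l ?nsq_ge0//.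
apply: le_trans (weighted_amgm s0 s1 (mulr_gt0 h0 (powR_gt0 (- 1) k0))
  (powR_gt0 (s / (1 - s)) k0)).
rewrite powRM ?powR_ge0 ?(ltW h0)// -!powRrM mulN1r divfK ?gt_eqF ?subr_gt0//.
by rewrite -mulrA powRN mulVf ?mulr1// gt_eqF// powR_gt0.
Qed.

End Variational.

(** * A trace inequality of Hoelder and Young type *)

Section Holder.
Variable R : realType.
Notation C := R[i].

Lemma qf_powmx_le n (A : 'M[C]_n) x y k v :
  (forall i, (v *m (spectralmx A)^t*) 0 i != 0 ->
     evals A i `^ x <= k * evals A i `^ y) ->
  qf (powmx A x) v <= k * qf (powmx A y) v.
Proof.
move=> h; rewrite [leLHS]qf_powmx [X in _ * X]qf_powmx.
rewrite mulr_sumr; apply: ler_sum => i _; set z := _ 0 i.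
have [z0|z0] := eqVneq z 0.
  by rewrite z0 (_ : nsq 0 = 0) ?mul0r ?mulr0//; apply/eqP; rewrite nsq_eq0.
by rewrite mulrCA ler_wpM2l ?nsq_ge0// h.
Qed.

Lemma qf_powmx_lt n (A : 'M[C]_n) x y k v : v != 0 ->
  (forall i, (v *m (spectralmx A)^t*) 0 i != 0 ->
     evals A i `^ x < k * evals A i `^ y) ->
  qf (powmx A x) v < k * qf (powmx A y) v.
Proof.
move=> v0 h; have w0 := mul_unitary_neq0 (spectral_unitarymx A) v0.
rewrite [ltLHS]qf_powmx [X in _ * X]qf_powmx mulr_sumr.
have [i wi0] : exists i, (v *m (spectralmx A)^t*) 0 i != 0.
  by apply/existsP; apply: contraR w0 => /existsPn H; apply/eqP/rowP => i;
     rewrite [RHS]mxE; apply/eqP; rewrite -[_ == _]negbK.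
have term_lt j : (v *m (spectralmx A)^t*) 0 j != 0 ->
    nsq ((v *m (spectralmx A)^t*) 0 j) * evals A j `^ x
    < k * (nsq ((v *m (spectralmx A)^t*) 0 j) * evals A j `^ y).
  move=> hj; rewrite mulrCA ltr_pM2l ?h// lt_neqAle nsq_ge0 andbT eq_sym.
  by rewrite nsq_eq0.
rewrite (bigD1 i)//= [ltRHS](bigD1 i)//= ltr_leD ?term_lt//.
apply: ler_sum => j _.
have [z0|/term_lt/ltW//] := eqVneq ((v *m (spectralmx A)^t*) 0 j) 0.
by rewrite z0 (_ : nsq 0 = 0) ?mul0r ?mulr0//; apply/eqP; rewrite nsq_eq0.
Qed.

Lemma qf_powmx_conj n (A B : 'M[C]_n) x y v :
  qf (powmx A x *m powmx B y *m powmx A x) v = qf (powmx B y) (v *m powmx A x).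
Proof.
rewrite -[X in _ *m _ *m X](adj_powmx A x).
exact: qf_conj.
Qed.

Lemma qf_powmx_sqr n (A : 'M[C]_n) x v : posdefmx A ->
  qf 1%:M (v *m powmx A x) = qf (powmx A (2 * x)) v.
Proof.
move=> pA; rewrite -qf_conj (mulmx1 (powmx A x)).
rewrite [X in _ *m X](adj_powmx A x) (powmxD pA).
by rewrite mulr_natl mulr2n.
Qed.

Lemma posdef_powmx_conj n (A B : 'M[C]_n) x y : posdefmx A -> posdefmx B ->
  posdefmx (powmx A x *m powmx B y *m powmx A x).
Proof.
move=> pA pB; rewrite -[X in _ *m _ *m X](adj_powmx A x).
exact: (posdef_conj (powmx_unit pA x) (posdef_powmx pB y)).
Qed.

Lemma Re_tr_powmx n (A : 'M[C]_n) x :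
  complex.Re (\tr (powmx A x)) = \sum_i evals A i `^ x.
Proof. by rewrite tr_powmx. Qed.

Lemma powmxK n (A : 'M[C]_n) x : posdefmx A -> powmx A x *m powmx A (- x) = 1%:M.
Proof. by move=> pA; rewrite (powmxD pA) subrr powmx0. Qed.

Lemma mul_powmx_neq0 n (A : 'M[C]_n) x (v : 'rV[C]_n) : posdefmx A -> v != 0 ->
  v *m powmx A x != 0.
Proof.
move=> pA; apply: contra => /eqP H.
by rewrite -[v]mulmx1 -(powmxK x pA) mulmxA H mul0mx.
Qed.

Lemma Re_tr_evals n (A : 'M[C]_n) : posdefmx A ->
  complex.Re (\tr A) = \sum_i evals A i.
Proof.
move=> pA; rewrite -{1}(hermitian_recmx pA.1) tr_recmx//.
exact: spectral_unitarymx.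
Qed.

Lemma Re_trD n (A B : 'M[C]_n) a b :
  complex.Re (\tr (a%:C *: A + b%:C *: B))
  = a * complex.Re (\tr A) + b * complex.Re (\tr B).
Proof. by rewrite mxtraceD !mxtraceZ ReD !ReZ. Qed.

(** Let [H] be the matrix on the left, [e] the exponent of its eigenvalues, and [M]
    the weighted mean of [X ^ r] and [Y ^ r].  If [v] is spanned by eigenvectors of
    [H] whose eigenvalues have an [e]-th power at least [c], then [qf_young] shows
    that the form of [M] at [w = v Y^y] is at least [c] times that of the identity.
    The hypothesis on [r] is the condition [1 <= p] of [qf_young]. *)
Lemma trace_young_base n (X Y : 'M[C]_n) x y r : posdefmx X -> posdefmx Y ->
  0 < x -> 0 < y -> 2 * x <= r ->
  \sum_i evals (powmx Y y *m powmx X (2 * x) *m powmx Y y) i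
      `^ (r / (2 * (x + y)))
   <= x / (x + y) * complex.Re (\tr (powmx X r))
      + y / (x + y) * complex.Re (\tr (powmx Y r)).
Proof.
move=> pX pY x0 y0 xr; have xy0 : 0 < x + y by rewrite addr_gt0.
have p1 : 1 <= r / (2 * x) by rewrite ler_pdivlMr ?mul1r//; lra.
have s0 : 0 <= r / (2 * y) by rewrite divr_ge0//; lra.
set H := _ *m _ *m _; have pH : posdefmx H := posdef_powmx_conj y (2 * x) pY pX.
set e := r / _; have e0 : 0 < e by rewrite divr_gt0//; lra.
set t := x / (x + y); have t0 : 0 < t by rewrite divr_gt0.
have t1 : t < 1 by rewrite ltr_pdivrMr// mul1r ltrDl.
have -> : y / (x + y) = 1 - t by rewrite /t; field; rewrite gt_eqF.
pose M := t%:C *: powmx X r + (1 - t)%:C *: powmx Y r.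
have u0 : 0 < 1 - t by rewrite subr_gt0.
have pM : posdefmx M :=
  posdefD (posdefZ t0 (posdef_powmx pX r)) (posdefZ u0 (posdef_powmx pY r)).
rewrite -Re_trD (Re_tr_evals pM).
apply: (@spectral_sum_le _ _ H M (powmx Y y) (fun z => z `^ e) id) => [j|].
  exact/ltW/evals_gt0.
move=> c v c0 v0 hH hM; set w := v *m powmx Y y in hM.
have w0 : w != 0 := mul_powmx_neq0 y pY v0.
have k0 : 0 < c `^ e^-1 by rewrite powR_gt0.
have qH : qf H v = qf (powmx X (2 * x)) w by exact: qf_powmx_conj.
have q1 : qf 1%:M v = qf (powmx Y (2 * - y)) w.
  by rewrite -(qf_powmx_sqr _ _ pY) /w -mulmxA (powmxK y pY) mulmx1.
have le1 : qf 1%:M v <= (c `^ e^-1)^-1 * qf H v.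
  suff : qf (powmx H 0) v <= (c `^ e^-1)^-1 * qf (powmx H 1) v.
    by rewrite powmx0 (powmx1 pH).
  apply: qf_powmx_le => i /hH.
  have h0 := evals_gt0 i pH.
  rewrite (powR_le_root c0 h0 e0) powRr0 (powRr1 (ltW h0)) => h.
  by rewrite mulrC ler_pdivlMr// mul1r.
have lt2 : qf M w < c * qf 1%:M w.
  suff : qf (powmx M 1) w < c * qf (powmx M 0) w by rewrite (powmx1 pM) powmx0.
  apply: (qf_powmx_lt w0) => i /hM /=.
  by rewrite powRr0 mulr1 (powRr1 (ltW (evals_gt0 i pM))).
have qX0 := posdef_qf_gt0 (posdef_powmx pX (2 * x)) w0.
have qY0 := posdef_qf_gt0 (posdef_powmx pY (2 * - y)) w0.
have := @qf_young _ _ X Y w (2 * x) (2 * - y) t (r / (2 * x)) (r / (2 * y))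
  pX pY w0 t0 t1 p1 s0.
have -> : t * (r / (2 * x)) = e by rewrite /t /e; field; rewrite !gt_eqF.
have -> : (1 - t) * (r / (2 * y)) = e by rewrite /t /e; field; rewrite !gt_eqF.
have -> : 2 * x * (r / (2 * x)) = r by field; rewrite gt_eqF.
have -> : 2 * - y * - (r / (2 * y)) = r by field; rewrite gt_eqF.
move=> /(_ erefl); rewrite -(qfZ t) -(qfZ (1 - t)) -qfD -/M.
apply/negP; rewrite -ltNge; apply: lt_le_trans lt2 _.
rewrite (ler_pM2r (qf1_gt0 w0)) (powR_le_root c0 (divr_gt0 qX0 qY0) e0).
rewrite (ler_pdivlMr _ _ qY0).
by move: le1; rewrite [leLHS]q1 [X in _ <= _ * X]qH (ler_pdivlMl _ _ k0).
Qed.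

Lemma tr_powmx_conj_div n (X Y : 'M[C]_n) y a b : posdefmx X -> posdefmx Y ->
  \tr (powmx Y y *m powmx X a *m powmx Y y
        *m powmx (powmx Y y *m powmx X b *m powmx Y y) (- 1))
  = \tr (powmx X (a - b)).
Proof.
move=> pX pY; rewrite (powmxN1 (posdef_powmx_conj y b pY pX)).
have uY := powmx_unit pY y; have uX := powmx_unit pX b.
rewrite -(powmxD pX) (_ : powmx X (- b) = invmx (powmx X b)); last first.
  by rewrite -[LHS](mulKmx uX) (powmxK b pX) mulmx1.
move: (powmx Y y) (powmx X a) (powmx X b) uY uX => T A B uT uB.
rewrite -!mulmxA mxtrace_mulC !mulmxA.
have uM : T *m B *m T \in unitmx by rewrite !unitmx_mul uT uB.
have E : B *m (T *m invmx (T *m B *m T) *m T) = 1%:M.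
  have BT : B *m T = invmx T *m (T *m B *m T) by rewrite -!mulmxA (mulKmx uT).
  by rewrite !mulmxA BT (mulmxK uM) (mulVmx uT).
by rewrite -[in RHS](mulmx1 (invmx B)) -E (mulKmx uB) !mulmxA.
Qed.

(** A Hoelder-Young inequality valid for every exponent: [Tr |S|^q], with
    [S = X^x Y^y] and [q = r / (x + y)], is at most the convex combination of
    [Tr X^r] and [Tr Y^r] with weights proportional to [x] and [y].  It holds by
    [trace_young_base] when [2 * x <= r]; the induction step replaces [x] by
    [x - r / 2] and keeps [y] and [r]. *)
Lemma trace_young n (X Y : 'M[C]_n) x y r : posdefmx X -> posdefmx Y ->
  0 < x -> 0 < y -> 0 < r ->
  \sum_i evals (powmx Y y *m powmx X (2 * x) *m powmx Y y) i
      `^ (r / (2 * (x + y)))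
   <= x / (x + y) * complex.Re (\tr (powmx X r))
      + y / (x + y) * complex.Re (\tr (powmx Y r)).
Proof.
move=> pX pY x0 y0 r0.
have [N] : exists N : nat, 2 * x <= N%:R * r.
  exists (Num.bound (2 * x / r)); rewrite -ler_pdivrMr//.
  by apply/ltW/archi_boundP; rewrite divr_ge0//; lra.
elim: N x x0 => [|N IH] x x0 hN; first by move: hN; rewrite mul0r; lra.
have [xr|xr] := leP (2 * x) r; first exact: trace_young_base.
pose x' := x - r / 2; have x'0 : 0 < x' by rewrite /x'; lra.
have hN' : 2 * x' <= N%:R * r.
  by move: hN; rewrite /x' -[N.+1%:R]natr1 mulrDl; lra.
have xy0 : 0 < x + y by rewrite addr_gt0.
have xy'0 : 0 < x' + y by rewrite addr_gt0.
pose s := r / (2 * (x + y)).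
have s0 : 0 < s by rewrite /s divr_gt0//; lra.
have s1 : s < 1 by rewrite /s ltr_pdivrMr ?mul1r//; lra.
have rxy : x * 2 - r + y * 2 != 0 by rewrite gt_eqF//; lra.
have sE : s / (1 - s) = r / (2 * (x' + y)).
  by rewrite /s /x'; field; rewrite rxy (gt_eqF xy0).
have cX : s + (1 - s) * (x' / (x' + y)) = x / (x + y).
  by rewrite /s /x'; field; rewrite rxy (gt_eqF xy0).
have cY : (1 - s) * (y / (x' + y)) = y / (x + y).
  by rewrite /s /x'; field; rewrite rxy (gt_eqF xy0).
have xE : 2 * x - 2 * x' = r by rewrite /x'; lra.
have {IH hN'} := IH x' x'0 hN'.
have := trace_powmx_variational (posdef_powmx_conj y (2 * x) pY pX)
  (posdef_powmx_conj y (2 * x') pY pX) s0 s1.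
rewrite (tr_powmx_conj_div y (2 * x) (2 * x') pX pY) sE xE => H IH.
apply: (le_trans H); rewrite -cX -cY.
have step (a b S TX TY : R) : S <= a * TX + b * TY ->
    s * TX + (1 - s) * S <= (s + (1 - s) * a) * TX + (1 - s) * b * TY.
  have u0 : 0 <= 1 - s by rewrite subr_ge0 ltW.
  by move=> /(ler_wpM2l u0); clear; lra.
exact: step IH.
Qed.

End Holder.

(** * The parallel sum *)

Section ParallelSum.
Variable R : realType.
Notation C := R[i].

(** [qf_young] with both resulting powers equal to the inverse.  The restriction on
    [t] is the condition that the exponent [(2 * t)^-1] is at least [1]. *)
Lemma qf_young_inv n (A B : 'M[C]_n) t k v : posdefmx A -> posdefmx B ->
  0 < t -> t <= 2^-1 -> 0 < k -> v != 0 ->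
  qf (powmx B (2 * (1 - t))) v < k `^ 2 * qf (powmx A (2 * - t)) v ->
  k^-1 * qf 1%:M v < t * qf (powmx A (- 1)) v + (1 - t) * qf (powmx B (- 1)) v.
Proof.
move=> pA pB t0 t12 k0 v0.
have qA0 := posdef_qf_gt0 (posdef_powmx pA (2 * - t)) v0.
have qB0 := posdef_qf_gt0 (posdef_powmx pB (2 * (1 - t))) v0.
have t1 : t < 1 by clear -t12; lra.
have u0 : 0 < 1 - t by clear -t12; lra.
have p1 : 1 <= (2 * t)^-1 by rewrite invf_ge1; clear -t0 t12; lra.
have s0 : 0 <= (2 * (1 - t))^-1 by rewrite invr_ge0; clear -t12; lra.
have := @qf_young _ _ A B v (2 * - t) (2 * (1 - t)) t _ _ pA pB v0 t0 t1 p1 s0.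
have -> : t * (2 * t)^-1 = 2^-1 by field; rewrite gt_eqF.
have -> : (1 - t) * (2 * (1 - t))^-1 = 2^-1 by field; rewrite gt_eqF.
have -> : 2 * - t * (2 * t)^-1 = - 1 by field; rewrite gt_eqF.
have -> : 2 * (1 - t) * - (2 * (1 - t))^-1 = - 1 by field; rewrite gt_eqF.
move=> /(_ erefl) h lt; apply: lt_le_trans h.
rewrite (ltr_pM2r (qf1_gt0 v0)).
have lt' : (k `^ 2)^-1 < qf (powmx A (2 * - t)) v / qf (powmx B (2 * (1 - t))) v.
  by rewrite (ltr_pdivlMr _ _ qB0) (ltr_pdivrMl _ _ (powR_gt0 2 k0)).
have i0 : (0 : R) < 2^-1 by rewrite invr_gt0 ltr0n.
have := gt0_ltr_powR i0 _ _ lt'; rewrite !nnegrE invr_ge0 powR_ge0.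
rewrite (ltW (divr_gt0 qA0 qB0)) -powRN -powRrM mulNr mulfV ?pnatr_eq0//.
by rewrite (powR_inv1 (ltW k0)); apply.
Qed.

Lemma qf_powmx_shift n (A : 'M[C]_n) x y v : posdefmx A ->
  qf (powmx A y) (v *m powmx A x) = qf (powmx A (x + y + x)) v.
Proof.
move=> pA; apply: etrans (esym (qf_powmx_conj A A x y v)) _.
by rewrite (powmxD pA x y) (powmxD pA (x + y) x).
Qed.

Lemma posdef_parsum n (X Y : 'M[C]_n) : posdefmx X -> posdefmx Y ->
  posdefmx (parsum X Y).
Proof.
by move=> pX pY; exact: (posdef_inv (posdefD (posdef_inv pX) (posdef_inv pY))).
Qed.

Lemma powmx_parsumN1 n (X Y : 'M[C]_n) : posdefmx X -> posdefmx Y ->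
  powmx (parsum X Y) (- 1) = powmx X (- 1) + powmx Y (- 1).
Proof.
move=> pX pY; rewrite (powmxN1 (posdef_parsum pX pY)) (powmxN1 pX) (powmxN1 pY).
by rewrite /parsum invmxK.
Qed.

(** The eigenvalues of [Z] and of the square root of [H] are compared through
    the form of the inverse of [Z]. *)
Lemma sum_evals_le_sqrt n (Z H T : 'M[C]_n) m r : posdefmx Z -> posdefmx H ->
  0 < r -> 0 < m ->
  (forall v k, v != 0 -> 0 < k ->
     (forall i, (v *m T *m (spectralmx H)^t*) 0 i != 0 -> evals H i < k `^ 2) ->
     k^-1 * qf 1%:M v < m * qf (powmx Z (- 1)) v) ->
  \sum_i evals Z i `^ r <= m `^ r * \sum_i evals H i `^ (r / 2).
Proof.
move=> pZ pH r0 m0 hZH; rewrite mulr_sumr.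
have E i : m `^ r * evals H i `^ (r / 2) = (m * evals H i `^ 2^-1) `^ r.
  by rewrite (powRM _ (ltW m0) (powR_ge0 _ _)) -powRrM [r / 2]mulrC.
rewrite (eq_bigr _ (fun i _ => E i)) {E}.
apply: (@spectral_sum_le _ _ Z H T (fun z => z `^ r)
  (fun h => (m * h `^ 2^-1) `^ r)).
  by move=> j; exact: powR_ge0.
move=> c v c0 v0 hZ hH; pose k := c `^ r^-1 / m.
have cr0 : 0 < c `^ r^-1 by rewrite powR_gt0.
have k0 : 0 < k by rewrite divr_gt0.
have leZ : qf (powmx Z (- 1)) v <= (c `^ r^-1)^-1 * qf 1%:M v.
  suff : qf (powmx Z (- 1)) v <= (c `^ r^-1)^-1 * qf (powmx Z 0) v.
    by rewrite powmx0.
  apply: qf_powmx_le => i /hZ; have z0 := evals_gt0 i pZ.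
  rewrite (powR_le_root c0 z0 r0) powRr0 mulr1 (powR_inv1 (ltW z0)) => h.
  by rewrite lef_pV2.
have ltH i : (v *m T *m (spectralmx H)^t*) 0 i != 0 -> evals H i < k `^ 2.
  have h0 := evals_gt0 i pH; move=> /hH.
  rewrite ltNge (powR_le_root c0 (mulr_gt0 m0 (powR_gt0 2^-1 h0)) r0) -ltNge.
  by rewrite mulrC -ltr_pdivlMr// => /(lt_powR2 h0).
have := hZH v k v0 k0 ltH.
by rewrite /k invf_div -mulrA (ltr_pM2l m0) ltNge leZ.
Qed.

(** The second inequality uses that [H] preserves its spectral subspaces. *)
Lemma qf_spectral_lt n (H : 'M[C]_n) k e : posdefmx H -> e != 0 ->
  (forall i, (e *m (spectralmx H)^t*) 0 i != 0 -> evals H i < k) ->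
  qf H e < k * qf 1%:M e /\ qf 1%:M (e *m H) < k * qf H e.
Proof.
move=> pH e0 h; split.
  suff : qf (powmx H 1) e < k * qf (powmx H 0) e by rewrite (powmx1 pH) powmx0.
  apply: (qf_powmx_lt e0) => i /h.
  by rewrite powRr0 mulr1 (powRr1 (ltW (evals_gt0 i pH))).
have E : qf 1%:M (e *m H) = qf (powmx H (2 * 1)) e.
  by rewrite -{1}(powmx1 pH); exact: qf_powmx_sqr.
rewrite [ltLHS]E -[X in _ < k * qf X e](powmx1 pH).
apply: (qf_powmx_lt e0) => i /h; have h0 := evals_gt0 i pH.
by rewrite mulr1 (powRr1 (ltW h0)) powR_mulrn ?ltW// expr2 ltr_pM2r.
Qed.

Lemma trace_parsum_le n (X Y : 'M[C]_n) r t : posdefmx X -> posdefmx Y ->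
  0 < r -> 0 < t -> t < 1 ->
  \sum_i evals (parsum X Y) i `^ r <=
   Num.max t (1 - t) `^ r *
   \sum_i evals (powmx Y t *m powmx X (2 * (1 - t)) *m powmx Y t) i `^ (r / 2).
Proof.
move=> pX pY r0 t0 t1; set m := Num.max _ _.
have u0 : 0 < 1 - t by rewrite subr_gt0.
have m0 : 0 < m by rewrite lt_max t0.
have tm : t <= m by rewrite le_max lexx.
have um : 1 - t <= m by rewrite le_max lexx orbT.
have pZ := posdef_parsum pX pY.
have pH := posdef_powmx_conj t (2 * (1 - t)) pY pX.
have inv_le v : v != 0 ->
    t * qf (powmx Y (- 1)) v + (1 - t) * qf (powmx X (- 1)) v
    <= m * qf (powmx (parsum X Y) (- 1)) v.
  move=> v0; have qX0 := posdef_qf_gt0 (posdef_powmx pX (- 1)) v0.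
  have qY0 := posdef_qf_gt0 (posdef_powmx pY (- 1)) v0.
  rewrite (powmx_parsumN1 pX pY) qfD addrC mulrDr.
  by apply: lerD; [rewrite (ler_pM2r qX0)|rewrite (ler_pM2r qY0)].
have [t12|t12] := leP t 2^-1.
  (* Here [v = e Y^t] with [e] in a spectral subspace of [H]. *)
  apply: (sum_evals_le_sqrt (T := powmx Y (- t)) pZ pH r0 m0) => v k v0 k0 hv.
  apply: lt_le_trans (inv_le v v0); apply: (qf_young_inv pY pX t0 t12 k0 v0).
  have [+ _] := qf_spectral_lt pH (mul_powmx_neq0 (- t) pY v0) hv.
  rewrite [X in X < _ -> _]qf_powmx_conj (qf_powmx_sqr _ _ pY) -mulmxA.
  by rewrite (powmxD pY (- t) t) addNr powmx0 mulmx1.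
(* Here [v = e Y^t X^(2(1-t))] with [e] in a spectral subspace of [H]. *)
have u12 : 1 - t <= 2^-1 by clear -t12; lra.
pose T := powmx X (- (2 * (1 - t))) *m powmx Y (- t).
apply: (sum_evals_le_sqrt (T := T) pZ pH r0 m0) => v k v0 k0 hv.
apply: lt_le_trans (inv_le v v0); rewrite addrC.
have := @qf_young_inv _ X Y (1 - t) k v pX pY u0 u12 k0 v0.
rewrite subKr; apply.
have w0 := mul_powmx_neq0 (- (2 * (1 - t))) pX v0.
have e0 := mul_powmx_neq0 (- t) pY w0; rewrite -mulmxA in e0.
have [_] := qf_spectral_lt pH e0 hv.
rewrite [X in _ < _ * X -> _]qf_powmx_conj.
have eY : v *m T *m powmx Y t = v *m powmx X (- (2 * (1 - t))).
  by rewrite /T mulmxA -[LHS]mulmxA (powmxD pY (- t) t) addNr powmx0 mulmx1.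
have eH : v *m T *m (powmx Y t *m powmx X (2 * (1 - t)) *m powmx Y t)
    = v *m powmx Y t.
  have assoc (V W : 'rV[C]_n) (A B D : 'M[C]_n) :
      V *m A = W -> W *m B = v -> V *m (A *m B *m D) = v *m D.
    by move=> VA WB; rewrite !mulmxA VA WB.
  apply: (assoc _ _ _ _ _ eY).
  rewrite -mulmxA (powmxD pX (- (2 * (1 - t))) (2 * (1 - t))) addNr.
  by rewrite powmx0 mulmx1.
rewrite eH eY [ltLHS](qf_powmx_sqr _ _ pY).
rewrite [X in _ < _ * X](qf_powmx_shift _ _ _ pX).
by rewrite addNr add0r mulrN.
Qed.

End ParallelSum.

(** * The trace inequality for the parallel sum *)

(** [powmx_powmx] merges the two functional calculi in the definition of the
    Schatten quasi-norm. *)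
Lemma schatten_powmxM (R : realType) n (X Y : 'M[R[i]]_n) r a b :
  posdefmx X -> 0 < r ->
  schatten r (powmx X a *m powmx Y b) `^ r
  = \sum_i evals (powmx Y b *m powmx X (2 * a) *m powmx Y b) i `^ (r / 2).
Proof.
move=> pX r0.
have E : (powmx X a *m powmx Y b)^t* *m (powmx X a *m powmx Y b)
    = powmx Y b *m powmx X (2 * a) *m powmx Y b.
  have gram (A B : 'M[R[i]]_n) : A^t* = A -> B^t* = B ->
      (A *m B)^t* *m (A *m B) = B *m (A *m A) *m B.
    by move=> hA hB; rewrite adjmxM hA hB !mulmxA.
  rewrite (gram _ _ (adj_powmx X a) (adj_powmx Y b)).
  have XX : powmx X a *m powmx X a = powmx X (2 * a).
    by rewrite (powmxD pX a a) mulr_natl mulr2n.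
  exact: (congr1 (fun M => powmx Y b *m M *m powmx Y b) XX).
rewrite /schatten /absmx E powmx_powmx Re_tr_powmx [2^-1 * r]mulrC.
rewrite -powRrM mulVf ?gt_eqF// powRr1// sumr_ge0// => i _.
exact: powR_ge0.
Qed.

Theorem theorem3p1 (R : realType) (n : nat) (X Y : 'M[R[i]]_n) (r t : R)
    (hX : posdefmx X) (hY : posdefmx Y) (hr : 0 < r) (ht0 : 0 < t) (ht1 : t < 1) :
  let m := Num.max t (1 - t) in
  \tr (powmx (parsum X Y) r)
    + ((m^-1 - m `^ r) * schatten r (powmx X (1 - t) *m powmx Y t) `^ r)%:C
  <= \tr (powmx X r) + \tr (powmx Y r).
Proof.
cbv zeta; set m := Num.max _ _; have u0 : 0 < 1 - t by rewrite subr_gt0.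
have m0 : 0 < m by rewrite lt_max ht0.
have tm : t <= m by rewrite le_max lexx.
have um : 1 - t <= m by rewrite le_max lexx orbT.
have main (Z S A B : R) : 0 <= A -> 0 <= B -> Z <= m `^ r * S ->
    S <= (1 - t) * A + t * B -> Z + (m^-1 - m `^ r) * S <= A + B.
  move=> A0 B0 hZ hS; rewrite mulrBl addrCA -lerBrDr opprB -[leLHS]addr0.
  have : m^-1 * S <= A + B.
    rewrite ler_pdivrMl// mulrDr (le_trans hS)//.
    by rewrite lerD// ler_wpM2r.
  by move: hZ; clear; lra.
rewrite (schatten_powmxM Y _ _ hX hr) [X in X + _ <= _]tr_powmx.
rewrite [X in _ <= X + _]tr_powmx [X in _ <= _ + X]tr_powmx -!rmorphD lecR.
apply: main; [by apply: sumr_ge0 => i _; exact: powR_ge0|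
              by apply: sumr_ge0 => i _; exact: powR_ge0|
              exact: trace_parsum_le|].
have := trace_young hX hY u0 ht0 hr.
rewrite subrK !divr1 mulr1 [X in _ <= _ * X + _]Re_tr_powmx.
by rewrite [X in _ <= _ + _ * X]Re_tr_powmx.
Qed.
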